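(* Suppose that $F$ is $\alpha$-fat for some $\alpha>0$. Let $h_N=\frac{\ln N}{2\alpha}$, let $L=\Theta(\log_2N)$ be such that $L\ge\frac{\log_2N}{2\alpha}$, and let $\gamma=\sqrt{\frac{4e^{\epsilon/L}(1+e^{\epsilon/L})h_N}{(e^{\epsilon/L}-1)^2N}}$. Then, in both the fixed data setting and the i.i.d. data setting, Algorithm A (defined in the context) with privacy parameter $\epsilon$, depth $L$ and threshold $\gamma$ incurs an error $$\mathrm{Err}=O\left(\left(\frac{\ln^3N}{\epsilon^2N}\right)^{1/(2\alpha)}\right).$$
   Context: There are $N\ge 2$ users; user $i$ holds $x_i\in[-1,1]$, and $x_{(1)}\le\dots\le x_{(N)}$ are the ordered data. Data generation is described by a non-decreasing function $F:[-1,1]\to[0,1]$ (not depending on $N$), and $x_{\min}=\inf\{x\in[-1,1]:F(x)>0\}$. Fixed data setting: the data are deterministic, with $F(x_{(i)})=(i-1)/(N-1)$ for all $i=1,\dots,N$, and $x_{(1)}=x_{\min}$. I.i.d. data setting: $F$ is the cumulative distribution function of a distribution supported on $[-1,1]$ and $x_1,\dots,x_N$ are drawn i.i.d. from it. $\alpha$-fatness: for $\alpha>0$, $F$ is $\alpha$-fat if there exist constants $C>0$ and $\bar x\in[-1,1]$ with $\bar x>x_{\min}$ such that $F(x)\ge C(x-x_{\min})^\alpha$ for all $x_{\min}<x<\bar x$. Randomized response with privacy parameter $\eta>0$: on input $s\in\{-1,1\}$ it outputs $s$ with probability $e^\eta/(1+e^\eta)$ and $-s$ with probability $1/(1+e^\eta)$,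 using fresh independent randomness. Let $\mathrm{sign}(x)=1$ if $x\ge0$ and $-1$ if $x<0$. Algorithm A (locally private minimum finding), with privacy parameter $\epsilon>0$, depth $L$ (a positive integer, which may depend on $N$), and threshold $\gamma$: set $\ell_1=-1$, $r_1=1$. For $t=1,\dots,L$: let $\tau_t=(\ell_t+r_t)/2$; each user $i$ reports $z'_i$, obtained by applying randomized response with privacy parameter $\epsilon/L$ to $\mathrm{sign}(\tau_t-x_i)$; the aggregator computes $\Phi'(z')=\frac1{2N}\frac{e^{\epsilon/L}+1}{e^{\epsilon/L}-1}\sum_{i=1}^Nz'_i+\frac12$; if $\Phi'(z')\ge\gamma$ set $(\ell_{t+1},r_{t+1})=(\ell_t,\tau_t)$, otherwise set $(\ell_{t+1},r_{t+1})=(\tau_t,r_t)$. Output $\tilde x=(\ell_{L+1}+r_{L+1})/2$. Error: $\mathrm{Err}=\mathbb E[|x_{\min}-\tilde x|]$, over the randomness of the algorithm and, in the i.i.d. setting, of the data. The asymptotics are as $N\to\infty$; $\epsilon$ may vary with $N$ but is bounded above, and the hidden constant may depend on $\alpha$, $C$, $\bar x$, the upper bound on $\epsilon$, and the constants in $L=\Theta(\log_2N)$.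
   Formalization: The hidden constant (and the threshold on N) may also depend on x_min, in addition to α, C, x̄, the upper bound on ε and the constants in L; without this the bound fails when x_min is close to x̄ and F is nearly flat beyond x̄. *)

(* Defs.v *)
From HB Require Import structures.
From mathcomp Require Import all_boot all_order all_algebra.
From mathcomp Require Import all_classical all_reals all_analysis.
Set Implicit Arguments.
Unset Strict Implicit.
Unset Printing Implicit Defensive.
Import Order.TTheory GRing.Theory Num.Theory.
Import numFieldNormedType.Exports.
Local Open Scope classical_set_scope.
Local Open Scope ring_scope.

(* [F : [-1,1] -> [0,1]] is encoded as a total function [R -> R] of which only
the values on [[-1,1]] are ever constrained or used. *)
Definition data_function (R : realType) (F : R -> R) : Prop :=
  (forall x, x \in `[-1, 1] -> 0 <= F x <= 1) /\
  {in `[-1, 1] &, forall x y, x <= y -> F x <= F y}.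

(* [inf] is [0] on the empty set; under [fat_with] below the set is nonempty. *)
Definition x_min (R : realType) (F : R -> R) : R :=
  inf [set x | x \in `[-1, 1] /\ 0 < F x].

Definition fat_with (R : realType) (F : R -> R) (alpha C xbar : R) : Prop :=
  [/\ 0 < C, xbar \in `[-1, 1], x_min F < xbar &
      forall x, x_min F < x < xbar -> C * (x - x_min F) `^ alpha <= F x].

(* [order_stat x k] is the (k+1)-st smallest of the [N] values of [x]. *)
Definition order_stat (R : realType) (N : nat) (x : 'I_N -> R) (k : nat) : R :=
  nth 0 (sort <=%R (codom x)) k.

Definition fixed_data (R : realType) (F : R -> R) (N : nat) (x : 'I_N -> R)
    : Prop :=
  [/\ forall i, x i \in `[-1, 1],
      forall k : 'I_N, F (order_stat x k) = k%:R / (N%:R - 1) &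
      order_stat x 0 = x_min F].

(* The product rule for all finite subfamilies is covered by taking the
   remaining [A i] equal to [setT]. *)
Definition mutually_independent (R : realType) (d : measure_display)
    (T : measurableType d) (P : probability T R) (N : nat)
    (X : 'I_N -> {RV P >-> R}) : Prop :=
  forall A : 'I_N -> set R, (forall i, measurable (A i)) ->
    P [set w | forall i, A i (X i w)] =
    (\prod_(i < N) P (X i @^-1` A i))%E.

Definition iid_data (R : realType) (F : R -> R) (d : measure_display)
    (T : measurableType d) (P : probability T R) (N : nat)
    (X : 'I_N -> {RV P >-> R}) : Prop :=
  [/\ forall i, distribution P (X i) `[-1, 1] = 1%E,
      forall i x, x \in `[-1, 1] -> cdf (X i) x = (F x)%:E &
      mutually_independent X].

(* Elements of [{-1, 1}] are encoded as booleans, [true] standing for [1]. *)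
Definition pm1 (R : realType) (b : bool) : R := if b then 1 else -1.

Definition sign_bit (R : realType) (x : R) : bool := 0 <= x.

(* Probability that randomized response outputs [z] on input [s]. *)
Definition rr_pmf (R : realType) (eta : R) (s z : bool) : R :=
  if z == s then expR eta / (1 + expR eta) else 1 / (1 + expR eta).

Notation reports N := {ffun 'I_N -> bool}.

Definition midpoint (R : realType) (I : R * R) : R := (I.1 + I.2) / 2.

Definition Phi' (R : realType) (N : nat) (eta : R) (z : reports N) : R :=
  1 / (2 * N%:R) * ((expR eta + 1) / (expR eta - 1)) *
    (\sum_(i < N) pm1 R (z i)) + 1 / 2.

(* The pair [(l_(t+1), r_(t+1))] computed from [I = (l_t, r_t)]. *)
Definition next_interval (R : realType) (N : nat) (eta gamma : R) (I : R * R)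
    (z : reports N) : R * R :=
  if gamma <= Phi' eta z then (I.1, midpoint I) else (midpoint I, I.2).

(* Probability that users with data [x] send the reports [z] when queried at
   [tau]. *)
Definition round_pmf (R : realType) (N : nat) (eta : R) (x : 'I_N -> R)
    (tau : R) (z : reports N) : R :=
  \prod_(i < N) rr_pmf eta (sign_bit (tau - x i)) (z i).

(* Probability of the successive reports [zs], starting from the interval [I]:
   since the randomness is fresh at every round, it is the product of the
   probabilities of the rounds, the query of each round being determined by the
   reports of the preceding ones. *)
Fixpoint transcript_pmf (R : realType) (N : nat) (eta gamma : R)
    (x : 'I_N -> R) (I : R * R) (zs : seq (reports N)) : R :=
  if zs is z :: zs' then
    round_pmf eta x (midpoint I) z *
    transcript_pmf eta gamma x (next_interval eta gamma I z) zs'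
  else 1.

Definition alg_output (R : realType) (N : nat) (eta gamma : R)
    (zs : seq (reports N)) : R :=
  midpoint (foldl (next_interval eta gamma) (-1, 1) zs).

(* Expected value of [|m - xtilde|] over the randomness of the algorithm, run on
   the data [x] with privacy parameter [eps], depth [L], threshold [gamma]. *)
Definition alg_error (R : realType) (N : nat) (eps : R) (L : nat) (gamma : R)
    (m : R) (x : 'I_N -> R) : R :=
  \sum_(zs : L.-tuple (reports N))
    transcript_pmf (eps / L%:R) gamma x (-1, 1) zs *
    `|m - alg_output (eps / L%:R) gamma zs|.

Definition log2 (R : realType) (x : R) : R := ln x / ln 2.

Definition h_param (R : realType) (alpha : R) (N : nat) : R :=
  ln N%:R / (2 * alpha).

Definition threshold (R : realType) (alpha eps : R) (L N : nat) : R :=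
  let e := expR (eps / L%:R) in
  Num.sqrt (4 * e * (1 + e) * h_param alpha N / ((e - 1) ^+ 2 * N%:R)).

Definition error_rate (R : realType) (alpha eps : R) (N : nat) : R :=
  (ln N%:R ^+ 3 / (eps ^+ 2 * N%:R)) `^ (1 / (2 * alpha)).

(* Main.v *)
Require Import Defs.
From HB Require Import structures.
From mathcomp Require Import all_boot all_order all_algebra.
From mathcomp Require Import all_classical all_reals all_analysis.
From mathcomp Require Import measurable_realfun.
From mathcomp Require Import ring lra zify.
Set Implicit Arguments.
Unset Strict Implicit.
Unset Printing Implicit Defensive.
Import Order.TTheory GRing.Theory Num.Theory.
Import numFieldNormedType.Exports.
Local Open Scope classical_set_scope.
Local Open Scope ring_scope.

(** Let Phi(tau) be the proportion of the data that is at most tau, and write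
e = exp (eps / L) and h = ln N / (2 alpha). The aggregate Phi' of a round is an
unbiased estimate of Phi(tau), being Phi(tau) plus a scaled sum of N
independent centred variables of variance 4 e / (1 + e)^2 each. A Chernoff
bound ([round_deviation]) shows that it deviates from Phi(tau) by gamma, in a
given direction, with probability at most exp (- N gamma^2 (e - 1)^2 / (4 e)).
The threshold gamma is the value for which this is exp (- (1 + e) h), hence at
most exp (- 2 h) = N^(- 1 / alpha), so that the L rounds together fail with
probability negligible against exp (- h) = N^(- 1 / (2 alpha))
([round_fail_threshold], [depth_fail_le]).

Suppose that all the data lie at or above a, and that a fraction at least
2 gamma of them lies at or below y. A round that does not deviate moves the
search to the right of a query below a, since Phi(tau) = 0 there, and to the
left of a query at or above y, since Phi(tau) >= 2 gamma there. Hence the search interval keeps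
l <= y and a <= r, and its midpoint ends within 2^(- L) of [a, y]. This gives
[expected_error_le_data]: the error is at most y - a + 2^(- L) plus 2 L times
the failure probability of a round; moreover 2^(- L) <= exp (- h), by the lower
bound on L.

By fatness, y = x_min + (4 gamma / C)^(1 / alpha) satisfies F(y) >= 4 gamma. In
the fixed setting the order statistics convert this into the required fraction
2 gamma of data up to y, with a = x_min. In the i.i.d. setting the queries
depend on the data, so an estimate uniform in tau seems necessary; but Phi is
monotone, so only the single point y matters, and there a binomial lower-tail
bound suffices ([iid_data_empirical_cdf_lt]). One takes a = x_min - 2^(- L),
below which there are almost surely no data.

Finally gamma^2 is at most a constant times ln^3 N / (eps^2 N), so that
y - x_min is of the order of the announced rate ([quantile_width_le]), which
also dominates exp (- h). The argument needs gamma smaller than a constant;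
otherwise the rate itself is bounded below ([rate_ge_of_threshold_ge]), and the
error never exceeds 2. *)

(** * Exponential tail bounds for products of two-point laws *)

(** The constant 1 in front of the square matters: with a constant 2 the failure
probability of a round would only be bounded by exp (- h), and L exp (- h)
exceeds the target rate for large alpha. *)
Lemma expR_le_quadratic (R : realType) (y : R) :
  y <= 1 / 3 -> expR y <= 1 + y + y ^+ 2.
Proof.
(* Compare the exponential with the inverse of (1 - y / 2)^2, a sharper upper
   bound than 1 / (1 - y). *)
move=> y3; have e1 : expR y * expR (- (y / 2)) ^+ 2 = 1.
  by rewrite expr2 -!expRD [X in expR X](_ : _ = 0) ?expR0//; field.
have e2 := expR_ge1Dx (- (y / 2)).
have e0 := expR_gt0 y.
have p0 : 0 < (1 - y / 2) ^+ 2 by apply: exprn_gt0; lra.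
rewrite -(ler_pM2r p0); apply: (@le_trans _ _ 1).
  by rewrite -[leRHS]e1 ler_pM2l//; apply: lerXn2r; rewrite ?nnegrE; lra.
have -> : (1 + y + y ^+ 2) * (1 - y / 2) ^+ 2 =
  1 + y ^+ 2 * (1 - 3 * y + y ^+ 2) / 4 by field.
by rewrite lerDl divr_ge0// mulr_ge0 ?sqr_ge0// addr_ge0 ?sqr_ge0//; lra.
Qed.

Lemma sum_product_pmf (R : realType) (I : finType) (q : I -> bool -> R) :
  (forall i, q i true + q i false = 1) ->
  \sum_(z : {ffun I -> bool}) \prod_i q i (z i) = 1.
Proof.
move=> q1; rewrite -(bigA_distr_bigA (fun i b => q i b)).
apply: big1 => i _.
by rewrite big_bool; exact: q1.
Qed.

(** The exponential Markov inequality. It serves both for the reports of a round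
and for the pattern of the data on either side of a point. *)
Lemma product_pmf_tail (R : realType) (I : finType) (q g : I -> bool -> R)
    (t : R) :
  (forall i b, 0 <= q i b) ->
  \sum_(z : {ffun I -> bool} | t <= \sum_i g i (z i)) \prod_i q i (z i) <=
    expR (- t) * \prod_i \sum_b q i b * expR (g i b).
Proof.
move=> q0; rewrite (bigA_distr_bigA (fun i b => q i b * expR (g i b))).
rewrite mulr_sumr [leRHS](bigID (fun z : {ffun I -> bool} =>
  t <= \sum_i g i (z i)))/=.
rewrite -[leLHS]addr0; apply: lerD; last first.
  apply: sumr_ge0 => z _; rewrite mulr_ge0 ?expR_ge0//.
  by apply: prodr_ge0 => i _; rewrite mulr_ge0 ?expR_ge0.
apply: ler_sum => z tz; rewrite big_split/= mulrCA -expR_sum -expRD.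
rewrite ler_peMr//; first by apply: prodr_ge0.
by rewrite -expR0 ler_expR addrC subr_ge0.
Qed.

(** * One round of randomized response *)

Section randomized_response.
Variables (R : realType) (eta : R).
Hypothesis eta_gt0 : 0 < eta.
Local Notation e := (expR eta).

(** The report minus its mean, as randomized response shrinks its input by the
factor (e - 1) / (e + 1). *)
Definition rr_dev (s z : bool) : R := pm1 R z - pm1 R s * ((e - 1) / (e + 1)).

Lemma rr_pmf_ge0 s z : 0 <= rr_pmf eta s z.
Proof.
have e0 := expR_gt0 eta.
by rewrite /rr_pmf; case: ifP => _; apply: divr_ge0 => //; lra.
Qed.

Lemma rr_pmf_sum1 s : rr_pmf eta s true + rr_pmf eta s false = 1.
Proof.
have e0 := expR_gt0 eta.
by rewrite /rr_pmf; case: s => /=; field; lra.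
Qed.

(** The factor 4 e / (1 + e)^2 is the variance of a report; deviations are at
most 2 in absolute value, so the restriction on mu keeps the exponents below
the bound 1 / 3 of [expR_le_quadratic]. *)
Lemma rr_mgf (mu : R) (s : bool) : `|mu| <= 1 / 6 ->
  \sum_b rr_pmf eta s b * expR (mu * rr_dev s b) <=
    expR (4 * e / (1 + e) ^+ 2 * mu ^+ 2).
Proof.
rewrite ler_norml => /andP[mu1 mu2]; have e0 := expR_gt0 eta.
have ep : 0 < e + 1 by lra.
have dev b : mu * rr_dev s b <= 1 / 3.
  have r1 : 0 <= 1 / (e + 1) <= 1.
    by apply/andP; split; [apply: divr_ge0; lra | rewrite ler_pdivrMr//; lra].
  have -> : rr_dev s b = pm1 R b - pm1 R s * (1 - 2 * (1 / (e + 1))).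
    by rewrite /rr_dev; congr (_ - _ * _); field; lra.
  move: r1; set r := 1 / (e + 1) => /andP[r0 r1].
  have [mr1 mr2] : - (1 / 6) <= mu * r /\ mu * r <= 1 / 6 by split; nra.
  have [ms1 ms2] : - (1 / 6) <= mu * (1 - r) /\ mu * (1 - r) <= 1 / 6.
    by split; nra.
  by case: b; case: s; rewrite /pm1 /=; lra.
apply: (@le_trans _ _ (1 + 4 * e / (1 + e) ^+ 2 * mu ^+ 2)); last first.
  exact: expR_ge1Dx.
apply: (@le_trans _ _ (\sum_b rr_pmf eta s b *
    (1 + mu * rr_dev s b + (mu * rr_dev s b) ^+ 2))).
  apply: ler_sum => b _; apply: ler_wpM2l; first exact: rr_pmf_ge0.
  exact: expR_le_quadratic.
rewrite big_bool /rr_pmf /rr_dev /pm1 le_eqVlt; apply/orP; left; apply/eqP.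
by case: s {dev} => /=; field; lra.
Qed.

Section round.
Variables (N : nat) (x : 'I_N -> R) (tau : R).
Hypothesis N_gt0 : (0 < N)%N.

Definition empirical_cdf : R := (\sum_(i < N) (x i <= tau)%R%:R) / N%:R.

Lemma round_pmf_ge0 z : 0 <= round_pmf eta x tau z.
Proof. by apply: prodr_ge0 => i _; exact: rr_pmf_ge0. Qed.

Lemma round_pmf_sum1 : \sum_z round_pmf eta x tau z = 1.
Proof.
apply: (@sum_product_pmf R 'I_N (fun i => rr_pmf eta (sign_bit (tau - x i)))).
by move=> i; exact: rr_pmf_sum1.
Qed.

(** The debiasing in Phi' is exact: what remains is a sum of centred terms. *)
Lemma Phi'_empirical_cdf (z : reports N) :
  Phi' eta z - empirical_cdf = 1 / (2 * N%:R) * ((e + 1) / (e - 1)) *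
    \sum_(i < N) rr_dev (sign_bit (tau - x i)) (z i).
Proof.
have e0 : 1 < e by rewrite -expR0 ltr_expR.
have n0 : (0 : R) < N%:R by rewrite ltr0n.
rewrite /rr_dev sumrB -mulr_suml.
have -> : \sum_(i < N) pm1 R (sign_bit (tau - x i)) =
    2 * (N%:R * empirical_cdf) - N%:R.
  rewrite /empirical_cdf [N%:R * _]mulrC divfK ?gt_eqF// mulr_sumr.
  rewrite -[X in _ = _ - X%:R]card_ord -sumr_const -sumrB.
  apply: eq_bigr => i _; rewrite /sign_bit subr_ge0.
  by case: (x i <= tau)%R; rewrite /pm1 /=; lra.
by rewrite /Phi'; field; rewrite !gt_eqF//; lra.
Qed.

(** The two directions of deviation are selected by [sg]. The bound on gamma
ensures that the optimal Chernoff exponent is admissible in [rr_mgf]. *)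
Lemma round_deviation (sg : bool) (gamma : R) :
  0 <= gamma -> gamma * e <= 1 / 3 ->
  \sum_(z | gamma <= pm1 R sg * (Phi' eta z - empirical_cdf))
    round_pmf eta x tau z <=
    expR (- (N%:R * gamma ^+ 2 * (e - 1) ^+ 2 / (4 * e))).
Proof.
move=> g0 ge; have e0 : 1 < e by rewrite -expR0 ltr_expR.
have n0 : (0 : R) < N%:R by rewrite ltr0n.
(* The Chernoff exponent, minimizing
   N lam ^ 2 * 4 e / (1 + e) ^ 2 - 2 lam gamma N (e - 1) / (e + 1). *)
pose lam := gamma * (e - 1) * (e + 1) / (4 * e).
pose mu := pm1 R sg * lam.
have lam0 : 0 <= lam by rewrite divr_ge0 ?mulr_ge0//; lra.
have lam6 : lam <= 1 / 6.
  by rewrite ler_pdivrMr; nra.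
have mu2 : mu ^+ 2 = lam ^+ 2 by rewrite /mu /pm1; case: (sg); ring.
have mu6 : `|mu| <= 1 / 6.
  by rewrite /mu /pm1 ler_norml; case: (sg); apply/andP; split; lra.
pose t := 2 * lam * gamma * N%:R * (e - 1) / (e + 1).
have := @product_pmf_tail R 'I_N (fun i => rr_pmf eta (sign_bit (tau - x i)))
  (fun i b => mu * rr_dev (sign_bit (tau - x i)) b) t (fun i => rr_pmf_ge0 _).
move=> H; apply: le_trans (le_trans H _).
  rewrite [leRHS]big_mkcond [leLHS]big_mkcond; apply: ler_sum => z _.
  case: ifPn => [gz|_]; last by case: ifP => // _; exact: round_pmf_ge0.
  rewrite ifT// -mulr_sumr.
  move: gz; rewrite Phi'_empirical_cdf; set S := \sum_i _ => gz.
  have := ler_wpM2l lam0 gz.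
  rewrite -(ler_pM2l (_ : 0 < 2 * N%:R * (e - 1) / (e + 1))); last first.
    by rewrite divr_gt0 ?mulr_gt0//; lra.
  congr (_ <= _); first by rewrite /t; field; lra.
  by rewrite /mu; field; rewrite !gt_eqF//; lra.
apply: (@le_trans _ _ (expR (- t) *
    \prod_(i < N) expR (4 * e / (1 + e) ^+ 2 * mu ^+ 2))).
  rewrite ler_wpM2l ?expR_ge0//; apply: ler_prod => i _.
  rewrite rr_mgf// andbT; apply: sumr_ge0 => b _.
  by rewrite mulr_ge0 ?expR_ge0 ?rr_pmf_ge0.
rewrite -expR_sum -expRD sumr_const card_ord mu2 ler_expR -mulr_natl.
rewrite le_eqVlt; apply/orP; left; apply/eqP.
by rewrite /t /lam; field; lra.
Qed.

End round.
End randomized_response.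

(** * The binary search *)

Lemma sum_tuple_cons (R : nmodType) (T : finType) (n : nat) (f : seq T -> R) :
  \sum_(s : n.+1.-tuple T) f s = \sum_x \sum_(s : n.-tuple T) f (x :: s).
Proof.
rewrite pair_big/=; pose u (p : T * n.-tuple T) := [tuple of p.1 :: p.2].
rewrite (reindex u)//=; exists (fun s => (thead s, [tuple of behead s])).
  by case=> x s _; rewrite /u /= theadE; congr pair; exact: val_inj.
by move=> s _; rewrite /u /= -tuple_eta.
Qed.

Section algorithm.
Variables (R : realType) (N : nat) (eta gamma : R) (x : 'I_N -> R).
Hypothesis eta_gt0 : 0 < eta.
Local Notation next := (@next_interval R N eta gamma).

(** The error of n rounds started from an arbitrary interval, so that it can be
computed by conditioning on the first round. *)
Definition expected_error (m : R) (n : nat) (I : R * R) : R :=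
  \sum_(zs : n.-tuple (reports N))
    transcript_pmf eta gamma x I zs * `|m - midpoint (foldl next I zs)|.

Lemma expected_error0 m I : expected_error m 0 I = `|m - midpoint I|.
Proof.
rewrite /expected_error (big_pred1 [tuple])/= ?mul1r// => zs.
by rewrite [zs]tuple0 /= eqxx.
Qed.

Lemma expected_errorS m n I : expected_error m n.+1 I =
  \sum_z round_pmf eta x (midpoint I) z * expected_error m n (next I z).
Proof.
rewrite /expected_error (sum_tuple_cons n (fun zs =>
  transcript_pmf eta gamma x I zs * `|m - midpoint (foldl next I zs)|))/=.
apply: eq_bigr => z _; rewrite mulr_sumr; apply: eq_bigr => zs _.
by rewrite mulrA.
Qed.

Definition subinterval11 (I : R * R) : Prop :=
  [/\ -1 <= I.1, I.1 <= I.2 & I.2 <= 1].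

Lemma next_subinterval11 I z : subinterval11 I -> subinterval11 (next I z).
Proof.
case: I => l r [/= l1 lr r1]; rewrite /next_interval /midpoint/=.
by case: ifP => _; split => /=; lra.
Qed.

Lemma expected_error_le2 m n I : -1 <= m <= 1 -> subinterval11 I ->
  expected_error m n I <= 2.
Proof.
move=> m1; elim: n I => [[l r] [/= l1 lr r1]|n IH I I11].
  by rewrite expected_error0 /midpoint/= ler_norml; lra.
rewrite expected_errorS -[leRHS]mul1r.
rewrite -[X in _ <= X * _](round_pmf_sum1 eta x (midpoint I)).
rewrite mulr_suml; apply: ler_sum => z _; apply: ler_wpM2l.
  exact: round_pmf_ge0.
by apply: IH; exact: next_subinterval11.
Qed.

Lemma expected_error_ge0 m n I : 0 <= expected_error m n I.
Proof.
elim: n I => [I|n IH I]; first by rewrite expected_error0.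
rewrite expected_errorS; apply: sumr_ge0 => z _.
by rewrite mulr_ge0// round_pmf_ge0.
Qed.

(** As long as no round errs, the interval keeps a left end at most y and a
right end at least a, and its length halves. A query below a can err in one
direction only, a query from y on in the other, and one in between in neither;
so each round errs with probability at most p, which costs at most 2. *)
Lemma expected_error_le (a y m p : R) (n : nat) (I : R * R) :
  -1 <= m <= 1 -> a <= m <= y -> 0 <= p ->
  (forall tau, tau < a ->
    \sum_(z | gamma <= Phi' eta z) round_pmf eta x tau z <= p) ->
  (forall tau, y <= tau ->
    \sum_(z | Phi' eta z < gamma) round_pmf eta x tau z <= p) ->
  subinterval11 I -> I.1 <= y -> a <= I.2 ->
  expected_error m n I <=
    y - a + (I.2 - I.1) / 2 ^+ n.+1 + 2 * n%:R * p.
Proof.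
move=> m1 /andP[am my] p0 up down; elim: n I => [|n IH] I I11 Iy Ia.
  case: I I11 Iy Ia => l r [/= l1 lr r1] ly ar.
  by rewrite expected_error0 /midpoint/= expr1 ler_norml; lra.
pose tau := midpoint I.
pose B := y - a + (I.2 - I.1) / 2 ^+ n.+2 + 2 * n%:R * p.
(* The reports that break the invariant l <= y, a <= r. *)
pose bad (z : reports N) := if gamma <= Phi' eta z then tau < a else y <= tau.
have bad_le : \sum_(z : reports N | bad z) round_pmf eta x tau z <= p.
  rewrite /bad; have [ta|ta] := ltP tau a.
    rewrite (eq_bigl (fun z : reports N => gamma <= Phi' eta z)) ?up// => z.
    by case: ifP => //= _; apply/negbTE; rewrite -ltNge; lra.
  have [yt|yt] := leP y tau.
    rewrite (eq_bigl (fun z : reports N => Phi' eta z < gamma)) ?down// => z.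
    by case: leP.
  by rewrite big1// => z; case: ifP.
rewrite expected_errorS -/tau; apply: (@le_trans _ _
    (\sum_z round_pmf eta x tau z * (B + 2 * (bad z)%:R))).
  apply: ler_sum => z _; apply: ler_wpM2l; first exact: round_pmf_ge0.
  have nI := next_subinterval11 z I11.
  have B0 : 0 <= B.
    rewrite /B; have [_ lr _] := I11.
    have : 0 <= (I.2 - I.1) / 2 ^+ n.+2 by rewrite divr_ge0 ?exprn_ge0//; lra.
    have : 0 <= 2 * n%:R * p by rewrite !mulr_ge0.
    by lra.
  case: (boolP (bad z)) => bz /=.
    by apply: (le_trans (expected_error_le2 n m1 nI)); lra.
  rewrite mulr0 addr0; apply: le_trans (IH _ nI _ _) _.
  - move: bz; rewrite /bad /next_interval; case: ifP => //= _.
    by rewrite -ltNge => /ltW.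
  - move: bz; rewrite /bad /next_interval; case: ifP => //= _.
    by rewrite -leNgt.
  - rewrite /B; have -> : (next I z).2 - (next I z).1 = (I.2 - I.1) / 2.
      by rewrite /next_interval /midpoint; case: ifP => _ /=; field.
    by rewrite -mulrA -invfM -exprS.
under eq_bigr do rewrite mulrDr.
rewrite big_split/= -mulr_suml (round_pmf_sum1 eta) mul1r.
have -> : \sum_(z : reports N) round_pmf eta x tau z * (2 * (bad z)%:R) =
    2 * \sum_(z : reports N | bad z) round_pmf eta x tau z.
  rewrite mulr_sumr [RHS]big_mkcond; apply: eq_bigr => z _.
  by case: (bad z) => /=; ring.
by rewrite /B -natr1; lra.
Qed.

Definition round_fail : R :=
  expR (- (N%:R * gamma ^+ 2 * (expR eta - 1) ^+ 2 / (4 * expR eta))).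

Lemma expected_error_le_data (a y m : R) (n : nat) :
  (0 < N)%N -> 0 < gamma -> gamma * expR eta <= 1 / 3 ->
  -1 <= m <= 1 -> a <= m <= y ->
  (forall i, a <= x i) -> 2 * gamma <= empirical_cdf x y ->
  expected_error m n (-1, 1) <= y - a + 1 / 2 ^+ n + 2 * n%:R * round_fail.
Proof.
move=> N0 g0 ge m1 amy ax xy.
have -> : 1 / 2 ^+ n = (1 - -1) / 2 ^+ n.+1 :> R.
  by rewrite exprS; field; rewrite expf_neq0.
apply: (@expected_error_le a y m _ n (-1, 1)) => //=;
  [exact: expR_ge0| | | | | ].
- move=> tau ta; have F0 : empirical_cdf x tau = 0.
    rewrite /empirical_cdf big1 ?mul0r// => i _.
    by rewrite leNgt (lt_le_trans ta).
  apply: le_trans (round_deviation eta_gt0 x tau N0 true (ltW g0) ge).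
  by under eq_bigl do rewrite -[X in _ <= X]subr0 -F0 -[X in _ <= X]mul1r.
- move=> tau yt; have F2 : 2 * gamma <= empirical_cdf x tau.
    apply: (le_trans xy); rewrite /empirical_cdf ler_wpM2r ?invr_ge0//.
    apply: ler_sum => i _; rewrite ler_nat.
    by case: (leP (x i) y) => // xiy; rewrite (le_trans xiy).
  apply: le_trans (round_deviation eta_gt0 x tau N0 false (ltW g0) ge).
  rewrite big_mkcond [leRHS]big_mkcond; apply: ler_sum => z _.
  case: ifPn => [zg|_]; last by case: ifP => // _; exact: round_pmf_ge0.
  by rewrite ifT// /pm1; lra.
- by split => /=; lra.
- by move: m1 amy; lra.
- by move: m1 amy; lra.
Qed.

End algorithm.

(** * Fat data functions *)

Section fat_function.
Variables (R : realType) (F : R -> R) (alpha C xbar : R).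
Hypotheses (alpha_gt0 : 0 < alpha) (F_data : data_function F).
Hypothesis F_fat : fat_with F alpha C xbar.
Local Notation m := (x_min F).
Local Notation S := [set x : R | x \in `[-1, 1] /\ 0 < F x].

Lemma fat_gt0 z : m < z < xbar -> 0 < F z.
Proof.
case: F_fat => C0 _ _ fatF mz; apply: lt_le_trans (fatF _ mz).
by rewrite mulr_gt0// powR_gt0// subr_gt0; case/andP: mz.
Qed.

(** Fatness makes the set that defines x_min nonempty: its infimum would
otherwise be 0, and the fatness lower bound would produce an element just
above 0. *)
Lemma x_min_itv : -1 <= m <= 1.
Proof.
case: F_fat => C0; rewrite in_itv/= => /andP[xb1 xb2] mx fatF.
have [S0|/set0P/negP/negPn/eqP S0] := pselect (S !=set0); last first.
  by rewrite /x_min S0 inf0; lra.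
have lbS : lbound S (-1) by move=> z [/=]; rewrite in_itv/= => /andP[].
apply/andP; split; first exact: lb_le_inf.
by apply: ltW; exact: lt_le_trans mx xb2.
Qed.

Lemma below_x_min z : -1 <= z -> z < m -> F z = 0.
Proof.
move=> z1 zm; have /andP[m1 m2] := x_min_itv.
have zI : z \in `[-1, 1] by rewrite in_itv/=; lra.
apply/eqP; rewrite eq_le; have /andP[-> _] := F_data.1 _ zI; rewrite andbT.
rewrite leNgt; apply/negP => Fz; move: zm; apply/negP; rewrite -leNgt.
apply: ge_inf; last by split.
by exists (-1) => y [/=]; rewrite in_itv/= => /andP[].
Qed.

(** The point at which the fatness lower bound takes the value g. *)
Lemma fat_quantile g : 0 < g -> g < C * (xbar - m) `^ alpha ->
  m + (g / C) `^ alpha^-1 < xbar /\ g <= F (m + (g / C) `^ alpha^-1).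
Proof.
case: F_fat => C0 _ mx fatF g0 gx.
set u := (g / C) `^ alpha^-1.
have gC : 0 < g / C by rewrite divr_gt0.
have u0 : 0 < u by rewrite powR_gt0.
have ua : u `^ alpha = g / C.
  by rewrite -powRrM mulVf ?gt_eqF// powRr1// ltW.
have ux : m + u < xbar.
  rewrite -ltrBrDl ltNge; apply/negP => xu.
  have : (xbar - m) `^ alpha <= u `^ alpha.
    apply: ge0_ler_powR; rewrite ?nnegrE//; first exact: ltW.
      by rewrite subr_ge0 ltW.
    exact: ltW.
  by rewrite ua ler_pdivlMr// mulrC leNgt gx.
split=> //; have := fatF (m + u).
rewrite [m + u - m]addrAC subrr add0r ua mulrCA divff ?gt_eqF// mulr1; apply.
by rewrite ux andbT ltrDl.
Qed.

End fat_function.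

(** * Fixed data *)

Section fixed_data.
Variables (R : realType) (F : R -> R) (N : nat) (x : 'I_N -> R).
Hypotheses (N_ge2 : (2 <= N)%N) (F_data : data_function F).
Hypothesis x_data : fixed_data F x.

Let sx := sort <=%R (codom x).

Let size_sx : size sx = N.
Proof. by rewrite size_sort size_codom card_ord. Qed.

Let sorted_sx : sorted <=%R sx.
Proof. by apply: sort_sorted; exact: le_total. Qed.

Lemma fixed_data_ge i : x_min F <= x i.
Proof.
case: x_data => _ _ <-; rewrite /order_stat.
have xi : x i \in sx by rewrite mem_sort codom_f.
have ix : (index (x i) sx < N)%N by rewrite -[X in (_ < X)%N]size_sx index_mem.
rewrite -(nth_index 0 xi); apply: (le_sorted_leq_nth 0 sorted_sx) => //.
  by rewrite inE/= size_sx; lia.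
by rewrite inE/= size_sx.
Qed.

Lemma empirical_cdf_count y : empirical_cdf x y = (count (<= y) sx)%:R / N%:R.
Proof.
rewrite /empirical_cdf -natr_sum; congr (_%:R / _).
rewrite count_sort count_map -sum1_count -big_enum/= big_mkcond [RHS]big_mkcond.
by apply: eq_bigr => i _; rewrite /=; case: (x i <= y)%R.
Qed.

(** With k data at or below y, the next order statistic exceeds y, so
4 gamma <= F y <= k / (N - 1); the factor 2 lost in the conclusion absorbs the
difference between N - 1 and N. *)
Lemma fixed_data_empirical_cdf_ge y gamma : y \in `[-1, 1] ->
  2 * gamma <= 1 -> 4 * gamma <= F y -> 0 <= gamma ->
  2 * gamma <= empirical_cdf x y.
Proof.
move=> y1 g1 gF g0; rewrite empirical_cdf_count; set k := count _ _.
have n0 : (0 : R) < N%:R by rewrite ltr0n; lia.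
rewrite ler_pdivlMr//.
have kN : (k <= N)%N by rewrite /k -[X in (_ <= X)%N]size_sx count_size.
move: kN; rewrite leq_eqVlt => /orP[/eqP ->|kN].
  by rewrite ler_piMl// ltW.
case: x_data => x1 Fk _.
have := Fk (Ordinal kN); rewrite /order_stat /= -/sx => Fxk.
have yk : y < nth 0 sx k.
  by apply: nth_count_gt => //; rewrite leqnn size_sx.
have xk1 : nth 0 sx k \in `[-1, 1].
  have : nth 0 sx k \in sx by rewrite mem_nth// size_sx.
  by rewrite mem_sort => /codomP[i ->].
have := F_data.2 y _ y1 xk1 (ltW yk); rewrite Fxk => FyN.
have n2 : (2 : R) <= N%:R by rewrite ler_nat.
have : 4 * gamma <= k%:R / (N%:R - 1) by exact: le_trans gF FyN.
rewrite ler_pdivlMr ?subr_gt0; last by lra.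
have : 0 <= gamma * (N%:R - 2) by rewrite mulr_ge0//; lra.
by nra.
Qed.

End fixed_data.

(** * Independent data *)

(** Monotonicity without measurability, because the integral of a nonnegative
function is a supremum over the simple functions below it. It spares the proof
that the error is a measurable function of the data. *)
Lemma ge0_le_integralT d (T : measurableType d) (R : realType)
    (mu : {measure set T -> \bar R}) (f g : T -> \bar R) :
  (forall w, 0 <= f w)%E -> (forall w, f w <= g w)%E ->
  (\int[mu]_w f w <= \int[mu]_w g w)%E.
Proof.
move=> f0 fg; have g0 w : (0 <= g w)%E by exact: le_trans (f0 w) (fg w).
rewrite !ge0_integralTE//; apply: ereal_sup_le => _ [h hf <-].
by exists h => // w; exact: le_trans (hf w) (fg w).
Qed.

Lemma measure_bigsetU_le d (T : measurableType d) (R : realType)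
    (mu : {measure set T -> \bar R}) (I : finType) (Q : pred I)
    (E : I -> set T) :
  (forall i, Q i -> measurable (E i)) ->
  (mu (\big[setU/set0]_(i | Q i) E i) <= \sum_(i | Q i) mu (E i))%E.
Proof.
move=> mE; suff : measurable (\big[setU/set0]_(i | Q i) E i) /\
  (mu (\big[setU/set0]_(i | Q i) E i) <= \sum_(i | Q i) mu (E i))%E by case.
apply: (big_ind2 (fun A s => measurable A /\ (mu A <= s)%E)).
- by rewrite measure0; split.
- move=> A s B t [mA As] [mB Bt]; split; first exact: measurableU.
  by apply: le_trans (leeD As Bt); exact: measureU2.
- by move=> i Qi; split; [exact: mE|].
Qed.

Lemma expectation_le_exceptional d (T : measurableType d) (R : realType)
    (P : probability T R) (f : T -> R) (B M p : R) (E : set T) :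
  0 <= B -> 0 <= M -> measurable E -> (P E <= p%:E)%E ->
  (forall w, 0 <= f w) -> (forall w, f w <= M) ->
  (forall w, ~ E w -> f w <= B) ->
  ('E_P[f] <= (B + M * p)%:E)%E.
Proof.
move=> B0 M0 mE Ep f0 fM fB; rewrite unlock.
apply: (@le_trans _ _ (\int[P]_w (cst B%:E w + M%:E * (\1_E w)%:E))%E).
  apply: ge0_le_integralT => w; rewrite lee_fin//=.
  rewrite indicE; have [Ew|Ew] := pselect (E w).
    by rewrite mem_set// mulr1; have := fM w; lra.
  by rewrite memNset// mulr0 addr0; exact: fB.
have m1 : measurable_fun [set: T] (EFin \o (\1_E : T -> R)).
  by apply/measurable_EFinP; exact: measurable_indic.
rewrite ge0_integralD//=; first last.
- exact: measurable_funeM.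
- by move=> w _; rewrite mule_ge0// lee_fin.
rewrite integral_cst// ge0_integralZl//.
rewrite integral_indic// setIT EFinD EFinM; apply: leeD.
  by rewrite [X in (_ * X)%E](_ : _ = 1%E) ?mule1//; exact: probability_setT.
by apply: lee_wpmul2l; rewrite ?lee_fin.
Qed.

Section iid_data.
Variables (R : realType) (F : R -> R) (d : measure_display).
Variables (T : measurableType d) (P : probability T R) (N : nat).
Variable X : 'I_N -> {RV P >-> R}.
Hypotheses (N_gt0 : (0 < N)%N) (X_data : iid_data F X).

(** When a < -1 the distribution function says nothing, and the support is used
instead. *)
Lemma iid_data_lt_null i a :
  (forall z, -1 <= z -> z <= a -> F z = 0) -> a <= 1 ->
  P (X i @^-1` `]-oo, a]) = 0%E.
Proof.
case: X_data => X1 XF _ Fa a1; have [a1'|a1'] := leP (-1) a.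
  have := XF i a; rewrite Fa// in_itv/= a1' a1 => /(_ isT).
  by [].
have := X1 i; rewrite /distribution /pushforward/= => Xi1.
have mI : measurable (X i @^-1` `[-1, 1]) by exact: measurable_funPTI.
apply/eqP; rewrite -measure_le0 -(subee (x := 1%E))// -[X in (1 - X)%E]Xi1.
rewrite -probability_setC//; apply: le_measure; rewrite ?inE.
- exact: measurable_funPTI.
- exact: measurableC.
- move=> w /=; rewrite !in_itv/= => Xa; apply/negP.
  by rewrite negb_and -ltNge (le_lt_trans Xa).
Qed.

Let thresh (y : R) (b : bool) : set R :=
  if b then `]-oo, y]%classic else `]y, +oo[%classic.

(** The event that the users marked by b are exactly those with a value at most
y: a product event, as the independence hypothesis requires. *)
Let pattern (y : R) (b : reports N) : set T :=
  [set w | forall i, thresh y (b i) (X i w)].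

Lemma iid_data_pattern y (b : reports N) : y \in `[-1, 1] ->
  P (pattern y b) = (\prod_(i < N) (if b i then F y else 1 - F y))%:E.
Proof.
case: X_data => _ XF XI y1.
rewrite /pattern (XI (fun i => thresh y (b i))); last first.
  by move=> i; rewrite /thresh; case: ifP.
rewrite -prodEFin; apply: eq_bigr => i _.
have XFi : P (X i @^-1` `]-oo, y]) = (F y)%:E by rewrite -(XF i).
rewrite /thresh; case: ifP => // _; rewrite EFinB -XFi -probability_setC.
  congr (P _); apply/seteqP; split => w /=; rewrite !in_itv/= andbT ltNge.
    by move/negP.
  by move/negP.
exact: measurable_funPTI.
Qed.

(** The lower tail of a binomial law of mean at least 4 gamma N, below half of
that value. The event is covered by the finitely many patterns with few marked
users, whose probabilities form a product law to which [product_pmf_tail]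
applies with exponent - 1 / 2 per marked user. *)
Lemma iid_data_empirical_cdf_lt y gamma : data_function F -> y \in `[-1, 1] ->
  4 * gamma <= F y ->
  exists E : set T, [/\ measurable E,
    (forall w, empirical_cdf (fun i => X i w) y < 2 * gamma -> E w) &
    (P E <= (expR (- (N%:R * gamma / 3)))%:E)%E].
Proof.
move=> F_data y1 gF; have [Fy0 Fy1] := andP (F_data.1 _ y1).
have n0 : (0 : R) < N%:R by rewrite ltr0n.
pose few (b : reports N) :=
  - (N%:R * gamma) <= \sum_i (- (1 / 2) * (b i)%:R : R).
exists (\big[setU/set0]_(b : reports N | few b) pattern y b).
have mpat b : measurable (pattern y b).
  rewrite (_ : pattern y b = \bigcap_i (X i @^-1` thresh y (b i))).
    apply: fin_bigcap_measurable => // i _; apply: measurable_funPTI.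
    by rewrite /thresh; case: ifP.
  by apply/seteqP; split => w /= H i; [move=> _|]; exact: H.
split; first by apply: bigsetU_measurable => b _; exact: mpat.
- move=> w fw; pose b := [ffun i => X i w <= y] : reports N.
  rewrite -(bigcup_pred few); exists b => /=; last first.
    move=> i; rewrite /thresh ffunE.
    by case: leP => /=; rewrite in_itv/= ?andbT.
  move: fw; rewrite unfold_in /few -mulr_sumr /empirical_cdf.
  rewrite ltr_pdivrMr// => fw.
  under eq_bigr do rewrite ffunE.
  by lra.
apply: le_trans (measure_bigsetU_le _ _) _ => //.
apply: (@le_trans _ _ (\sum_(b : reports N | few b)
    (\prod_(i < N) (if b i then F y else 1 - F y))%:E)%E).
  apply: lee_sum => b _; rewrite le_eqVlt; apply/orP; left; apply/eqP.
  exact: iid_data_pattern.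
rewrite sumEFin lee_fin.
apply: le_trans (@product_pmf_tail R 'I_N
  (fun _ b => if b then F y else 1 - F y) (fun _ b => - (1 / 2) * b%:R) _ _) _.
  by move=> _ []; lra.
rewrite opprK.
apply: (@le_trans _ _ (expR (N%:R * gamma) *
    \prod_(i < N) expR (- (4 * gamma / 3)))).
  rewrite ler_wpM2l ?expR_ge0//; apply: ler_prod => i _.
  rewrite big_bool/= !mulr0 mulr1 expR0 mulr1; apply/andP; split.
    by rewrite addr_ge0// ?mulr_ge0 ?expR_ge0//; lra.
  (* Each factor is at most 1 - F y / 3, hence at most exp (- 4 gamma / 3). *)
  have e1 : expR (- (1 / 2)) <= 2 / 3 :> R.
    rewrite expRN -[leRHS]invrK lef_pV2 ?posrE ?expR_gt0//.
    by apply: le_trans (expR_ge1Dx _); lra.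
  by apply: le_trans (expR_ge1Dx _); nra.
rewrite -expR_sum -expRD sumr_const card_ord ler_expR -mulr_natl.
by rewrite le_eqVlt; apply/orP; left; apply/eqP; field.
Qed.

End iid_data.

(** * The choice of the threshold and of the depth *)

Section parameters.
Variables (R : realType) (alpha eps epsmax c2 : R) (L N : nat).
Hypotheses (alpha_gt0 : 0 < alpha) (c2_gt0 : 0 < c2).
Hypotheses (eps_bounds : 0 < eps <= epsmax) (L_gt0 : (0 < L)%N).
Hypotheses (L_lower : log2 N%:R / (2 * alpha) <= L%:R).
Hypotheses (L_upper : L%:R <= c2 * log2 N%:R).
Hypotheses (N_ge_e : expR 1 <= N%:R :> R).
Local Notation h := (h_param alpha N).
Local Notation gamma := (threshold alpha eps L N).
Local Notation e := (expR (eps / L%:R)).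
Local Notation Q := (ln (N%:R : R) ^+ 3 / (eps ^+ 2 * N%:R)).
Local Notation rate := (error_rate alpha eps N).

Let eps_gt0 : 0 < eps. Proof. by case/andP: eps_bounds. Qed.
Let N_gt0 : (0 : R) < N%:R.
Proof. by apply: lt_le_trans N_ge_e; exact: expR_gt0. Qed.
Let lnN_ge1 : (1 : R) <= ln N%:R.
Proof. by rewrite -[leLHS](expRK 1) ler_ln ?posrE ?expR_gt0. Qed.
Let ln2_gt0 : (0 : R) < ln 2. Proof. by rewrite ln_gt0// ltr1n. Qed.
Let L_pos : (0 : R) < L%:R. Proof. by rewrite ltr0n. Qed.
Let h_gt0 : 0 < h.
Proof.
by rewrite divr_gt0 ?mulr_gt0 ?(lt_le_trans ltr01 lnN_ge1).
Qed.

Lemma privacy_per_round_gt0 : 0 < eps / L%:R. Proof. exact: divr_gt0. Qed.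

Let e_gt1 : 1 < e.
Proof. by rewrite -[X in X < _]expR0 ltr_expR privacy_per_round_gt0. Qed.

Lemma expR_per_round_le : e <= expR epsmax.
Proof.
rewrite ler_expR; apply: (@le_trans _ _ eps); last by case/andP: eps_bounds.
by rewrite ler_pdivrMr// ler_peMr ?ler1n// ltW.
Qed.

Lemma threshold_sqr :
  gamma ^+ 2 = 4 * e * (1 + e) * h / ((e - 1) ^+ 2 * N%:R).
Proof.
have e1 := e_gt1.
rewrite /threshold sqr_sqrtr// divr_ge0//.
  by apply: mulr_ge0 (ltW h_gt0); rewrite !mulr_ge0//; lra.
by rewrite mulr_ge0 ?sqr_ge0 ?ltW.
Qed.

Let den_gt0 : 0 < (e - 1) ^+ 2 * N%:R.
Proof.
have e1 := e_gt1.
by rewrite mulr_gt0// exprn_gt0//; lra.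
Qed.

Lemma threshold_gt0 : 0 < gamma.
Proof.
have e1 := e_gt1.
rewrite /threshold sqrtr_gt0 divr_gt0//.
by apply: mulr_gt0 h_gt0; rewrite !mulr_gt0//; lra.
Qed.

(** The exponent equals (1 + e) h, and e > 1. *)
Lemma round_fail_threshold :
  round_fail N (eps / L%:R) gamma <= expR (- (2 * h)).
Proof.
have e1 := e_gt1; have n0 := N_gt0; have h0 := h_gt0.
rewrite /round_fail ler_expR lerN2 threshold_sqr.
have -> : N%:R * (4 * e * (1 + e) * h / ((e - 1) ^+ 2 * N%:R)) * (e - 1) ^+ 2
    / (4 * e) = (1 + e) * h.
  by field; rewrite !gt_eqF//; lra.
by rewrite ler_pM2r//; lra.
Qed.

Definition threshold_const : R :=
  4 * expR epsmax * (1 + expR epsmax) * c2 ^+ 2 / (2 * alpha * ln 2 ^+ 2).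

Lemma threshold_const_gt0 : 0 < threshold_const.
Proof.
have l2 := ln2_gt0.
have E0 := expR_gt0 epsmax.
by rewrite divr_gt0// !mulr_gt0 ?exprn_gt0//; lra.
Qed.

(** Since e - 1 >= eps / L, the square of the threshold is of order
h L^2 / (eps^2 N), and L is at most of order ln N. *)
Lemma threshold_sqr_le : gamma ^+ 2 <= threshold_const * Q.
Proof.
have e_1 := e_gt1; have lnN1 := lnN_ge1; have h0 := h_gt0.
have E0 := expR_gt0 epsmax; have eE := expR_per_round_le.
have lnN0 : (0 : R) < ln N%:R by lra.
rewrite threshold_sqr ler_pdivrMr//.
apply: (@le_trans _ _ (4 * expR epsmax * (1 + expR epsmax) * h)).
  rewrite ler_pM2r// -2!mulrA ler_pM2l//; apply: ler_pM; lra.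
have e1 : (eps / L%:R) ^+ 2 <= (e - 1) ^+ 2.
  rewrite ler_pXn2r ?nnegrE//; first by have := expR_ge1Dx (eps / L%:R); lra.
    by rewrite ltW// privacy_per_round_gt0.
  by lra.
have L1 : L%:R ^+ 2 <= (c2 * log2 N%:R) ^+ 2.
  rewrite ler_pXn2r ?nnegrE//.
  by apply: le_trans L_upper; exact: ltW.
have T0 : 0 <= threshold_const * Q.
  rewrite mulr_ge0 ?(ltW threshold_const_gt0)//.
  by rewrite divr_ge0 ?exprn_ge0 ?mulr_ge0 ?sqr_ge0// ltW.
apply: (@le_trans _ _ (threshold_const * Q * ((eps / L%:R) ^+ 2 * N%:R))).
  have -> : threshold_const * Q * ((eps / L%:R) ^+ 2 * N%:R) =
      4 * expR epsmax * (1 + expR epsmax) * h *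
      ((c2 * log2 N%:R) ^+ 2 / L%:R ^+ 2).
    by rewrite /threshold_const /h_param /log2; field; rewrite !gt_eqF.
  rewrite ler_peMr//.
    by apply: mulr_ge0 (ltW h0); rewrite !mulr_ge0//; lra.
  by rewrite ler_pdivlMr ?exprn_gt0// mul1r.
by rewrite ler_wpM2l// ler_wpM2r// ltW.
Qed.

(** As gamma^2 >= 4 h / N, it is enough that 9 h <= 4 N, which follows from
ln N <= 2 sqrt N for N as large as assumed. *)
Lemma sample_fail_threshold : 81 / (16 * alpha ^+ 2) <= N%:R ->
  expR (- (N%:R * gamma / 3)) <= expR (- h).
Proof.
have e1 := e_gt1.
move=> Na; rewrite ler_expR lerN2.
have n0 : (0 : R) <= N%:R by exact: ltW.
pose s := Num.sqrt (N%:R : R).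
have s0 : 0 < s by rewrite sqrtr_gt0.
have sE : s ^+ 2 = N%:R by rewrite sqr_sqrtr.
have as9 : 9 / 4 <= alpha * s.
  have : (9 / 4) ^+ 2 <= (alpha * s) ^+ 2.
    rewrite [leRHS]exprMn sE; move: Na.
    rewrite ler_pdivrMr ?mulr_gt0 ?exprn_gt0//.
    by lra.
  have p9 : (0 : R) <= 9 / 4 by lra.
  have as0 : 0 <= alpha * s by rewrite mulr_ge0// ltW.
  by rewrite ler_pXn2r ?nnegrE.
have lnN : ln (N%:R : R) <= 2 * s.
  rewrite -sE lnXn// -mulr_natl.
  have := @le_ln1Dx R (s - 1); rewrite addrCA subrr addr0 => /(_ _).
  by have := s0; lra.
have hN : h <= 4 / 9 * N%:R.
  rewrite /h_param ler_pdivrMr ?mulr_gt0//; apply: (le_trans lnN); rewrite -sE.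
  have := ler_wpM2r (ltW s0) as9; lra.
have g1 : 4 * h / N%:R <= gamma ^+ 2.
  rewrite threshold_sqr ler_pdivlMr// mulrAC ler_pdivrMr//.
  have -> : 4 * h * ((e - 1) ^+ 2 * N%:R) = 4 * (e - 1) ^+ 2 * h * N%:R by ring.
  by rewrite ler_pM2r// ler_pM2r//; have := e_gt1; nra.
rewrite -(@ler_pXn2r _ 2)// ?nnegrE ?(ltW h_gt0)//; last first.
  by rewrite divr_ge0// mulr_ge0// ltW// threshold_gt0.
have -> : (N%:R * gamma / 3) ^+ 2 = gamma ^+ 2 * N%:R ^+ 2 / 9 by field.
have : 4 * h * N%:R <= gamma ^+ 2 * N%:R ^+ 2.
  have := ler_wpM2r (sqr_ge0 (N%:R : R)) g1; congr (_ <= _).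
  by field; rewrite gt_eqF.
have := ler_wpM2l (ltW h_gt0) hN; lra.
Qed.

Lemma half_pow_depth_le : 1 / 2 ^+ L <= expR (- h).
Proof.
have -> : 1 / 2 ^+ L = expR (- (L%:R * ln 2)) :> R.
  by rewrite expRN expRM_natl lnK ?posrE// div1r.
rewrite ler_expR lerN2; have := ler_wpM2r (ltW ln2_gt0) L_lower.
congr (_ <= _); rewrite /log2 /h_param.
by field; rewrite !gt_eqF.
Qed.

(** L is at most a multiple of h, and h exp (- h) <= 1 absorbs it. *)
Lemma depth_fail_le :
  L%:R * expR (- (2 * h)) <= c2 * (2 * alpha) / ln 2 * expR (- h).
Proof.
have -> : expR (- (2 * h)) = expR (- h) * expR (- h).
  by rewrite -expRD; congr expR; ring.
rewrite mulrA ler_pM2r ?expR_gt0//.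
apply: (@le_trans _ _ (c2 * log2 N%:R * expR (- h))).
  by rewrite ler_pM2r ?expR_gt0.
have -> : log2 (N%:R : R) = 2 * alpha / ln 2 * h.
  by rewrite /log2 /h_param; field; rewrite !gt_eqF.
have he : h * expR (- h) <= 1.
  rewrite expRN -ler_pdivlMr ?invr_gt0 ?expR_gt0// invrK mul1r.
  by have := expR_ge1Dx h; lra.
have k0 : 0 <= c2 * (2 * alpha) / ln 2.
  by apply: divr_ge0 (ltW ln2_gt0); rewrite !mulr_ge0// ltW.
have := ler_wpM2l k0 he.
by rewrite mulr1; congr (_ <= _); field; rewrite gt_eqF.
Qed.

Lemma error_rate_scale k : 0 <= k ->
  (k * Q) `^ (1 / (2 * alpha)) = k `^ (1 / (2 * alpha)) * rate.
Proof.
have lnN1 := lnN_ge1.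
move=> k0; rewrite powRM//; apply: divr_ge0; first by apply: exprn_ge0; lra.
exact: mulr_ge0 (sqr_ge0 _) (ltW N_gt0).
Qed.

Let Q_gt0 : 0 < Q.
Proof.
have lnN1 := lnN_ge1; have n0 := N_gt0; have ep := eps_gt0.
by rewrite divr_gt0 ?mulr_gt0 ?exprn_gt0//; lra.
Qed.

Let powR_mono (u v : R) : 0 <= u -> u <= v ->
  u `^ (1 / (2 * alpha)) <= v `^ (1 / (2 * alpha)).
Proof.
move=> u0 uv; apply: ge0_ler_powR; rewrite ?nnegrE//; last exact: le_trans uv.
by rewrite divr_ge0// mulr_ge0// ltW.
Qed.

(** Here the upper bound on eps enters: 1 / N <= epsmax^2 ln^3 N / (eps^2 N). *)
Lemma expRN_h_le :
  expR (- h) <= (epsmax ^+ 2) `^ (1 / (2 * alpha)) * rate.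
Proof.
have lnN1 := lnN_ge1; have n0 := N_gt0.
rewrite -error_rate_scale ?sqr_ge0//.
have -> : expR (- h) = (N%:R^-1) `^ (1 / (2 * alpha)).
  rewrite -[X in X^-1](lnK N_gt0) -expRN -expRM; congr expR.
  by rewrite /h_param; field; rewrite gt_eqF.
apply: powR_mono; first by rewrite invr_ge0 ltW.
rewrite mulrA ler_pdivlMr ?mulr_gt0 ?exprn_gt0//.
have -> : (N%:R^-1 * (eps ^+ 2 * N%:R) : R) = eps ^+ 2.
  by field; rewrite gt_eqF.
have : 1 <= ln (N%:R : R) ^+ 3 by rewrite exprn_ege1.
have : eps ^+ 2 <= epsmax ^+ 2 by case/andP: eps_bounds => e0 e1; nra.
have := sqr_ge0 epsmax; nra.
Qed.

Lemma quantile_width_le C : 0 < C ->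
  (4 * gamma / C) `^ alpha^-1 <=
    (16 * threshold_const / C ^+ 2) `^ (1 / (2 * alpha)) * rate.
Proof.
move=> C0; have T0 := threshold_const_gt0; have g0 := threshold_gt0.
rewrite -error_rate_scale; last first.
  by rewrite divr_ge0 ?sqr_ge0// mulr_ge0// ltW.
have -> : alpha^-1 = 2%:R * (1 / (2 * alpha)) by field; rewrite gt_eqF.
rewrite powRrM powR_mulrn; last by rewrite divr_ge0 ?mulr_ge0 ?ltW.
apply: powR_mono; first exact: sqr_ge0.
have -> : (4 * gamma / C) ^+ 2 = 16 / C ^+ 2 * gamma ^+ 2.
  by field; rewrite gt_eqF.
rewrite [16 * _ / _]mulrAC -[leRHS]mulrA.
rewrite ler_pM2l; last by rewrite divr_gt0// exprn_gt0.
exact: threshold_sqr_le.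
Qed.

(** For a threshold that is not small, the announced rate is no better than a
constant. *)
Lemma rate_ge_of_threshold_ge gamma0 : 0 <= gamma0 -> gamma0 <= gamma ->
  (gamma0 ^+ 2 / threshold_const) `^ (1 / (2 * alpha)) <= rate.
Proof.
move=> g0 gg; have T0 := threshold_const_gt0; apply: powR_mono.
  by rewrite divr_ge0 ?sqr_ge0 ?ltW.
rewrite ler_pdivrMr// mulrC; apply: le_trans threshold_sqr_le.
by rewrite ler_pXn2r ?nnegrE// (le_trans g0).
Qed.

End parameters.

(** * The error of the algorithm *)

Unset Implicit Arguments.

Theorem corollary1 (R : realType) (alpha C xbar m epsmax c1 c2 : R)
    (alpha_gt0 : 0 < alpha) (c1_gt0 : 0 < c1) (c2_gt0 : 0 < c2) :
  exists (K : R) (N0 : nat),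
  forall F : R -> R,
    data_function F -> x_min F = m -> fat_with F alpha C xbar ->
  forall (N : nat) (eps : R) (L : nat),
    (2 <= N)%N -> (N0 <= N)%N ->
    0 < eps <= epsmax ->
    (0 < L)%N ->
    c1 * log2 N%:R <= L%:R <= c2 * log2 N%:R ->
    log2 N%:R / (2 * alpha) <= L%:R ->
    let gamma := threshold alpha eps L N in
    (forall x : 'I_N -> R, fixed_data F x ->
      alg_error eps L gamma (x_min F) x <= K * error_rate alpha eps N) /\
    (forall (d : measure_display) (T : measurableType d) (P : probability T R)
        (X : 'I_N -> {RV P >-> R}), iid_data F X ->
      ('E_P[fun w => alg_error eps L gamma (x_min F) (fun i => X i w)]
         <= (K * error_rate alpha eps N)%:E)%E).
Proof.
(* [K0] covers large thresholds, [K1] the width y - x_min, and [K2] the terms of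
   order exp (- h): two interval lengths, the data exception and L rounds. *)
pose r : R := 1 / (2 * alpha); pose A := threshold_const alpha epsmax c2.
pose gamma0 := Num.min (1 / (3 * expR epsmax)) (C * (xbar - m) `^ alpha / 4).
pose K0 := 2 / (gamma0 ^+ 2 / A) `^ r.
pose K1 := (16 * A / C ^+ 2) `^ r.
pose K2 := (4 + 2 * (c2 * (2 * alpha) / ln 2)) * (epsmax ^+ 2) `^ r.
exists (K0 + (K1 + K2)).
exists (maxn (Num.bound (expR 1 : R)) (Num.bound (81 / (16 * alpha ^+ 2)))).
move=> F F_data Fm F_fat N eps L N2; rewrite geq_max => /andP[N_e N_a].
move=> eps_bd L0 /andP[_ L_up] L_low gamma.
have N0 : (0 < N)%N by lia.
have Ne : expR 1 <= N%:R :> R.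
  apply: ltW; apply: lt_le_trans (archi_boundP (expR_ge0 _)) _.
  by rewrite ler_nat.
have Na : 81 / (16 * alpha ^+ 2) <= N%:R.
  have a0 : 0 <= 81 / (16 * alpha ^+ 2).
    by rewrite divr_ge0// mulr_ge0// sqr_ge0.
  by apply: ltW; apply: lt_le_trans (archi_boundP a0) _; rewrite ler_nat.
have [C0 xb1 mx _] := F_fat; rewrite Fm in mx.
have m1 := x_min_itv F_fat; rewrite Fm in m1.
have l2 : (0 : R) < ln 2 by rewrite ln_gt0// ltr1n.
have eta0 := privacy_per_round_gt0 eps_bd L0.
have g0 : 0 < gamma by exact: (threshold_gt0 alpha_gt0 eps_bd L0 Ne).
have E0 := expR_gt0 epsmax.
have w0 : 0 < C * (xbar - m) `^ alpha by rewrite mulr_gt0// powR_gt0// subr_gt0.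
have gamma0_gt0 : 0 < gamma0.
  by rewrite lt_min !divr_gt0// mulr_gt0.
have rate0 : 0 <= error_rate alpha eps N by exact: powR_ge0.
have A0 : 0 < A by exact: threshold_const_gt0.
have K0_ge0 : 0 <= K0 by rewrite divr_ge0// powR_ge0.
have K1_ge0 : 0 <= K1 by exact: powR_ge0.
have k2 : 0 <= c2 * (2 * alpha) / ln 2.
  by apply: divr_ge0 (ltW l2); rewrite !mulr_ge0// ltW.
have K2_ge0 : 0 <= K2 by rewrite mulr_ge0 ?powR_ge0//; lra.
have I11 : subinterval11 ((-1, 1) : R * R) by split => /=; lra.
have err_le2 (x : 'I_N -> R) : alg_error eps L gamma (x_min F) x <= 2.
  by rewrite Fm; exact: expected_error_le2.
(* For a large threshold, compare the trivial bound 2 with the rate. *)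
have [gg|gg] := leP gamma0 gamma.
  have rate_ge : 2 <= (K0 + (K1 + K2)) * error_rate alpha eps N.
    have := rate_ge_of_threshold_ge alpha_gt0 c2_gt0 eps_bd L0 L_up Ne
      (ltW gamma0_gt0) gg.
    rewrite -/r -/A => rate_ge; have p0 : 0 < (gamma0 ^+ 2 / A) `^ r.
      by rewrite powR_gt0// divr_gt0// exprn_gt0.
    have := ler_wpM2l K0_ge0 rate_ge; rewrite {1}/K0 divfK ?gt_eqF//.
    have : 0 <= (K1 + K2) * error_rate alpha eps N by rewrite mulr_ge0//; lra.
    by lra.
  split=> [x _|d T P X _]; first exact: le_trans (err_le2 x) rate_ge.
  apply: le_trans (expectation_le_exceptional (B := 2) (M := 2) (p := 0)
    (E := set0) _ _ _ _ _ _ _) _ => //.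
  - by rewrite measure0.
  - by move=> w; exact: expected_error_ge0.
  by rewrite mulr0 addr0 lee_fin.
move: gg; rewrite lt_min => /andP[gE gC].
have e_le := expR_per_round_le eps_bd L0.
have ge : gamma * expR (eps / L%:R) <= 1 / 3.
  move: gE; rewrite ltr_pdivlMr ?mulr_gt0// => gE.
  have := ler_wpM2l (ltW g0) e_le; lra.
have g1 : 2 * gamma <= 1.
  have : 1 < expR (eps / L%:R) by rewrite -[X in X < _]expR0 ltr_expR.
  by have := expR_gt0 epsmax; nra.
have gC4 : 4 * gamma < C * (xbar - x_min F) `^ alpha by rewrite Fm; lra.
have g4 : 0 < 4 * gamma by lra.
have [] := fat_quantile alpha_gt0 F_fat g4 gC4; rewrite Fm.
set u := (4 * gamma / C) `^ alpha^-1; set y := m + u => yx gy.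
have u0 : 0 <= u by exact: powR_ge0.
have y1 : y \in `[-1, 1].
  by move: xb1; rewrite !in_itv/=; rewrite /y in yx *; lra.
have u_le := quantile_width_le alpha_gt0 c2_gt0 eps_bd L0 L_up Ne C0.
have h_le := expRN_h_le alpha_gt0 eps_bd Ne.
have half_le := half_pow_depth_le alpha_gt0 L_low.
have fail_le := depth_fail_le alpha_gt0 c2_gt0 L_up.
have rf_le := round_fail_threshold alpha_gt0 eps_bd L0 Ne.
have rfL : L%:R * round_fail N (eps / L%:R) gamma <=
    c2 * (2 * alpha) / ln 2 * expR (- h_param alpha N).
  apply: le_trans fail_le; exact: ler_wpM2l.
have data_le a (x : 'I_N -> R) : a <= m -> (forall i, a <= x i) ->
    2 * gamma <= empirical_cdf x y ->
    alg_error eps L gamma m x <= u + (m - a) + 1 / 2 ^+ L +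
      2 * (c2 * (2 * alpha) / ln 2) * expR (- h_param alpha N).
  move=> am ax xy; apply: le_trans (@expected_error_le_data R N (eps / L%:R)
    gamma x eta0 a y m L N0 g0 ge m1 _ ax xy) _.
    by rewrite am/= lerDl.
  by rewrite /y; lra.
(* The coefficient 4 suffices for both settings: 2 for the two terms 2^(- L) and
   2 for the exceptional event of the i.i.d. setting. *)
have total : u + (4 + 2 * (c2 * (2 * alpha) / ln 2)) * expR (- h_param alpha N)
    <= (K0 + (K1 + K2)) * error_rate alpha eps N.
  have K0r := mulr_ge0 K0_ge0 rate0.
  have K1r : u <= K1 * error_rate alpha eps N by exact: u_le.
  have K2r : (4 + 2 * (c2 * (2 * alpha) / ln 2)) * expR (- h_param alpha N) <=
      K2 * error_rate alpha eps N.
    by rewrite /K2 -[leRHS]mulrA; apply: ler_wpM2l => //; lra.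
  by rewrite (mulrDl K0) (mulrDl K1); lra.
split=> [x x_data|d T P X X_data].
  apply: le_trans (data_le m x _ _ _) _ => //.
  - by move=> i; rewrite -Fm; exact: fixed_data_ge x_data i.
  - exact: (fixed_data_empirical_cdf_ge N2 F_data x_data y1 g1 gy (ltW g0)).
  by have := expR_ge0 (- h_param alpha N); lra.
have [E [mE fewE PE]] := iid_data_empirical_cdf_lt N0 X_data F_data y1 gy.
(* Below x_min rather than at it, so that [cdf] alone shows that no datum lies
   at or below a; the shift costs no more than the final resolution. *)
pose a := m - 1 / 2 ^+ L.
have am : a < m by rewrite /a ltrBlDr ltrDl divr_gt0// exprn_gt0.
pose low := \big[setU/set0]_(i < N) (X i @^-1` `]-oo, a]).
have mlow i : measurable (X i @^-1` `]-oo, a]) by exact: measurable_funPTI.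
have low0 : (P low <= 0)%E.
  apply: le_trans (measure_bigsetU_le _ _) _ => //.
  rewrite big1// => i _; apply: (iid_data_lt_null X_data); last by lra.
  by move=> z z1 za; apply: (below_x_min F_data F_fat) => //; rewrite Fm; lra.
have PE' : (P (E `|` low) <= (expR (- h_param alpha N))%:E)%E.
  apply: le_trans (measureU2 _ _ _) _ => //; first exact: bigsetU_measurable.
  rewrite -[leRHS]adde0; apply: leeD => //; apply: le_trans PE _.
  by rewrite lee_fin; exact: (sample_fail_threshold alpha_gt0 eps_bd L0 Ne Na).
pose B := u + (2 + 2 * (c2 * (2 * alpha) / ln 2)) * expR (- h_param alpha N).
apply: le_trans (expectation_le_exceptional (B := B) (M := 2)
  _ _ _ PE' _ _ _) _ => //.
- by rewrite /B addr_ge0// mulr_ge0 ?expR_ge0//; lra.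
- by apply: measurableU => //; exact: bigsetU_measurable.
- by move=> w; exact: expected_error_ge0.
- by move=> w; rewrite -Fm; exact: err_le2.
- move=> w good; apply: le_trans (data_le a _ (ltW am) _ _) _.
  + move=> i; rewrite leNgt; apply/negP => Xa; apply: good; right.
    rewrite /low -(bigcup_pred predT); exists i => //=.
    by rewrite in_itv/= ltW.
  + by rewrite leNgt; apply/negP => few; apply: good; left; exact: fewE.
  by rewrite /B /a; lra.
by rewrite lee_fin /B; lra.
Qed.
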